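(* Let $(X_{\varphi}, \Gamma, \Phi_{\varphi})$ and $(X'_{\varphi'}, \Gamma', \Phi'_{\varphi'})$ be Cantor actions associated to renormalizations $\varphi \colon \Gamma \to \Gamma$ and $\varphi' \colon \Gamma' \to \Gamma'$, respectively, of finitely generated groups $\Gamma$ and $\Gamma'$. If the actions are continuously orbit equivalent, then their discriminant groups $\mathcal{D}_{\varphi}$ and $\mathcal{D}'_{\varphi'}$ are isomorphic.
   Context: A renormalization of a countable group $\Gamma$ is an injective homomorphism $\varphi\colon\Gamma\to\Gamma$ whose image is a proper subgroup of finite index. Put $\Gamma_0=\Gamma$, $\Gamma_\ell=\varphi^\ell(\Gamma)$, $X_\ell=\Gamma/\Gamma_\ell$ (left cosets), and let $X_\varphi=\varprojlim X_\ell$ be the inverse limit under the natural quotient maps $X_{\ell+1}\to X_\ell$; it is a Cantor space. The left translation actions of $\Gamma$ on the $X_\ell$ induce a minimal equicontinuous action $\Phi_\varphi\colon\Gamma\to\mathrm{Homeo}(X_\varphi)$. Let $\widehat{\Gamma}_\varphi$ be the closure of $\Phi_\varphi(\Gamma)$ in $\mathrm{Homeo}(X_\varphi)$ in the uniform topology; it is a profinite group acting on $X_\varphi$. Let $x_\varphi=(e\Gamma_\ell)_{\ell\ge 0}\in X_\varphi$. The discriminant group is $\mathcal{D}_\varphi=\{\widehat g\in\widehat\Gamma_\varphi \mid \widehat g\, x_\varphi=x_\varphi\}$. The objects $X'_{\varphi'},\Phi'_{\varphi'},\mathcal{D}'_{\varphi'}$ are defined in the same way from $\varphi'\colon\Gamma'\to\Gamma'$.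 A continuous orbit equivalence between actions $(\mathfrak{X},\Gamma,\Phi)$ and $(\mathfrak{X}',\Gamma',\Phi')$ on Cantor spaces is a homeomorphism $h\colon\mathfrak{X}\to\mathfrak{X}'$ which maps the orbit equivalence relation $\{(x,\gamma x)\}$ of $\Phi$ onto that of $\Phi'$ (and similarly for $h^{-1}$), together with continuous functions $\alpha\colon\Gamma\times\mathfrak{X}\to\Gamma'$ and $\beta\colon\Gamma'\times\mathfrak{X}'\to\Gamma$ (groups discrete) such that: (1) for each $x\in\mathfrak{X}$ and $\gamma\in\Gamma$ there is an open set $U_x\ni x$ with $\Phi'(\alpha(\gamma,x))\circ h|U_x=h\circ\Phi(\gamma)|U_x$; (2) for each $y\in\mathfrak{X}'$ and $\gamma'\in\Gamma'$ there is an open set $V_y\ni y$ with $\Phi(\beta(\gamma',y))\circ h^{-1}|V_y=h^{-1}\circ\Phi'(\gamma')|V_y$. The maps $\alpha,\beta$ are not assumed to be cocycles. *)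

(* Defs.v *)
From HB Require Import structures.
From mathcomp Require Import all_boot finmap.
From mathcomp Require Import all_classical.
From mathcomp Require Import topology.

Set Warnings "-redundant-canonical-projection".
Set Implicit Arguments.
Unset Strict Implicit.
Unset Printing Implicit Defensive.

Local Open Scope classical_set_scope.
Local Open Scope group_scope.

Record homeomorphism (X Y : topologicalType) := Homeomorphism {
  homeo_fun :> X -> Y;
  homeo_inv : Y -> X;
  homeo_funK : cancel homeo_fun homeo_inv;
  homeo_invK : cancel homeo_inv homeo_fun;
  homeo_continuous : continuous homeo_fun;
  homeo_inv_continuous : continuous homeo_inv
}.

Lemma homeoP (X Y : topologicalType) (f g : homeomorphism X Y) :
  f =1 g -> f = g.
Proof.
case: f g => [f f' fK f'K cf cf'] [g g' gK g'K cg cg'] /= /funext fg.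
have f'g' : f' = g'.
  by apply/funext => y; rewrite -{1}[y]g'K -fg fK.
move: fK f'K cf cf' gK g'K cg cg'; rewrite fg f'g' => *.
by congr Homeomorphism; apply: Prop_irrelevance.
Qed.

Definition Homeo (X : topologicalType) : Type := homeomorphism X X.

Section HomeoGroup.
Context {X : topologicalType}.
Implicit Types f g : homeomorphism X X.

Definition homeo_id : homeomorphism X X :=
  @Homeomorphism X X id id (fun=> erefl) (fun=> erefl)
    (fun=> cvg_id) (fun=> cvg_id).

Definition homeo_sym f : homeomorphism X X :=
  Homeomorphism (@homeo_invK _ _ f) (@homeo_funK _ _ f)
    (@homeo_inv_continuous _ _ f) (@homeo_continuous _ _ f).

Lemma homeo_comp_continuous f g : continuous (f \o g).
Proof.
by move=> x; apply: continuous_comp; apply: homeo_continuous.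
Qed.

Lemma homeo_comp_inv_continuous f g :
  continuous (homeo_inv g \o homeo_inv f).
Proof.
by move=> x; apply: continuous_comp; apply: homeo_inv_continuous.
Qed.

Definition homeo_comp f g : homeomorphism X X :=
  Homeomorphism
    (can_comp (@homeo_funK _ _ f) (@homeo_funK _ _ g))
    (can_comp (@homeo_invK _ _ g) (@homeo_invK _ _ f))
    (@homeo_comp_continuous f g) (@homeo_comp_inv_continuous f g).

HB.instance Definition _ := gen_eqMixin (Homeo X).
HB.instance Definition _ := gen_choiceMixin (Homeo X).

Fact homeo_mulA : associative homeo_comp. Proof. by move=> f g h; exact: homeoP. Qed.
Fact homeo_mul1g : left_id homeo_id homeo_comp. Proof. by move=> f; exact: homeoP. Qed.
Fact homeo_mulg1 : right_id homeo_id homeo_comp. Proof. by move=> f; exact: homeoP. Qed.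
Fact homeo_mulVg : left_inverse homeo_id homeo_sym homeo_comp.
Proof. by move=> f; apply: homeoP => x /=; rewrite homeo_funK. Qed.
Fact homeo_mulgV : right_inverse homeo_id homeo_sym homeo_comp.
Proof. by move=> f; apply: homeoP => x /=; rewrite homeo_invK. Qed.

HB.instance Definition _ := isGroup.Build (Homeo X)
  homeo_mulA homeo_mul1g homeo_mulg1 homeo_mulVg homeo_mulgV.

End HomeoGroup.

(** [Homeo X] carries the topology of uniform convergence of the maps; the group
    law is composition, [f * g = f \o g]. *)
HB.instance Definition _ (X : uniformType) :=
  Topological.copy (Homeo X)
    (initial_topology (fun f : Homeo X => (f : X -> X) : {uniform X -> X})).

Definition finitely_generated (G : groupType) : Prop :=
  exists s : seq G, forall S : {pred G},
    group_closed S -> {subset s <= S} -> S =i predT.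

Section Cosets.
Context {G : groupType}.
Implicit Types (g : G) (A H : set G).

Definition translate g A : set G := [set g * a | a in A].

Definition cosets H : set (set G) := [set translate g H | g in setT].

Definition finite_index H : Prop := finite_set (cosets H).

End Cosets.

Definition renormalization (G : groupType) (phi : UMagmaMorphism.type G G) :=
  [/\ countable [set: G], injective phi, range phi != setT
    & finite_index (range phi)].

Section RenormalizationAction.
Context {G : groupType} (phi : UMagmaMorphism.type G G).
Implicit Types (g : G) (l : nat).

Definition subgroup_ l : set G := range (iter l phi).

Lemma subgroup_1 l : subgroup_ l 1.
Proof.
exists 1 => //; elim: l => //= l ->; exact: gmulf1.
Qed.

Lemma subgroup_M l g h : subgroup_ l g -> subgroup_ l h -> subgroup_ l (g * h).
Proof.
move=> [a _ <-] [b _ <-]; exists (a * b) => //.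
by elim: l => //= l ->; exact: gmulfM.
Qed.

Lemma subgroup_S l : subgroup_ l.+1 `<=` subgroup_ l.
Proof. by move=> _ [a _ <-]; exists (phi a); rewrite // -iterSr. Qed.

(** Left cosets are represented as subsets of [G]. *)
Definition coset_space l : uniformType :=
  discrete_topology (cosets (subgroup_ l)).

Lemma coset_space_subproof l g : translate g (subgroup_ l) \in cosets (subgroup_ l).
Proof. by apply: mem_set; exists g. Qed.

Definition coset l g : coset_space l :=
  exist _ (translate g (subgroup_ l)) (coset_space_subproof l g).

Lemma coset_quotient_subproof l (C : coset_space l.+1) :
  [set c * k | c in set_val C & k in subgroup_ l] \in cosets (subgroup_ l).
Proof.
case: C => C CG; have /set_mem[g _ gC] := CG; rewrite set_valE /=.
apply: mem_set; exists g => //; apply/seteqP; split.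
  move=> _ [k kl <-]; exists g; last by exists k.
  by rewrite -gC; exists 1; [exact: subgroup_1 | exact: mulg1].
move=> _ [c + [k kl <-]]; rewrite -gC => -[h /subgroup_S hl <-].
by exists (h * k); [exact: subgroup_M | rewrite mulgA].
Qed.

(** The natural quotient map sends [g Gamma_(l+1)] to
    [g Gamma_(l+1) Gamma_l = g Gamma_l]. *)
Definition coset_quotient l (C : coset_space l.+1) : coset_space l :=
  exist _ [set c * k | c in set_val C & k in subgroup_ l]
    (coset_quotient_subproof C).

Lemma coset_quotientE l g : coset_quotient (coset l.+1 g) = coset l g.
Proof.
apply: eq_sig_hprop => [? ? ?|/=]; first exact: Prop_irrelevance.
rewrite set_valE /=; apply/seteqP; split.
  move=> _ [_ [h /subgroup_S hl <-] [k kl <-]].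
  by exists (h * k); [exact: subgroup_M | rewrite mulgA].
move=> _ [k kl <-]; exists g; last by exists k.
by exists 1; [exact: subgroup_1 | exact: mulg1].
Qed.

Lemma coset_surj l (C : coset_space l) : exists g, C = coset l g.
Proof.
case: C => C CG; have /set_mem[g _ gC] := CG; exists g.
by apply: eq_sig_hprop => [? ? ?|//]; exact: Prop_irrelevance.
Qed.

Lemma coset_act_subproof l g (C : coset_space l) :
  translate g (set_val C) \in cosets (subgroup_ l).
Proof.
case: C => C CG; have /set_mem[h _ hC] := CG; rewrite set_valE /=.
apply: mem_set; exists (g * h) => //; rewrite -hC.
apply/seteqP; split=> [_ [k kl <-]|_ [_ [k kl <-] <-]].
  by exists (h * k); [exists k | rewrite mulgA].
by exists k => //; rewrite mulgA.
Qed.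

Definition coset_act l g (C : coset_space l) : coset_space l :=
  exist _ (translate g (set_val C)) (coset_act_subproof g C).

Lemma coset_actE l g h : coset_act g (coset l h) = coset l (g * h).
Proof.
apply: eq_sig_hprop => [? ? ?|/=]; first exact: Prop_irrelevance.
rewrite set_valE /=; apply/seteqP; split=> [_ [_ [k kl <-] <-]|_ [k kl <-]].
  by exists k => //; rewrite mulgA.
by exists (h * k); [exists k | rewrite mulgA].
Qed.

(** The uniformity is the one induced by the product of the discrete
    uniformities; see [entourage_limitP] for its base of entourages. *)
Definition inverse_limit : uniformType :=
  [set x : prod_topology coset_space |
    forall l, coset_quotient (x l.+1) = x l].

Definition coord (x : inverse_limit) l : coset_space l := set_val x l.

Lemma coordS (x : inverse_limit) l : coset_quotient (coord x l.+1) = coord x l.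
Proof. by case: x => x xP; exact: (set_mem xP l). Qed.

Definition mk_limit (x : forall l, coset_space l)
  (xS : forall l, coset_quotient (x l.+1) = x l) : inverse_limit :=
  exist _ (x : prod_topology coset_space) (mem_set xS).

Definition basepoint : inverse_limit :=
  @mk_limit (fun l => coset l 1) (fun l => coset_quotientE l 1).

Lemma limit_eqP (x y : inverse_limit) : (forall l, coord x l = coord y l) -> x = y.
Proof.
case: x y => [x xP] [y yP] xy; apply: eq_sig_hprop => [? ? ?|/=].
  exact: Prop_irrelevance.
exact: functional_extensionality_dep.
Qed.

Lemma coord_le (x y : inverse_limit) m l : (m <= l)%N ->
  coord x l = coord y l -> coord x m = coord y m.
Proof.
move=> /subnK <-; elim: (l - m)%N => [//|n IH] xy; apply: IH.
by rewrite addSn in xy; rewrite -coordS xy coordS.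
Qed.

Lemma entourage_limitP (E : set (inverse_limit * inverse_limit)) :
  entourage E <->
  exists l, [set xy | coord xy.1 l = coord xy.2 l] `<=` E.
Proof.
split=> [[F [_ [D DI <-] DF] FE]|[l lE]].
  have [l lD] : exists l, forall p, p \in D -> ((projT1 p).1 <= l)%N.
    exists (\max_(p <- enum_fset D) ((projT1 p).1 : nat))%N => p pD.
    exact: (@leq_bigmax_seq _ (enum_fset D) xpredT
      (fun p => (projT1 p).1 : nat) p).
  exists l => -[x y] /= xy; apply: FE; apply: DF => /= p pD.
  have := lD _ pD; case: p {pD} => -[i B] /= /asboolP [C entC CB] il.
  apply: CB; have xyi : coord x i = coord y i by exact: coord_le il xy.
  suff : C (coord x i, coord y i) by [].
  by rewrite xyi; exact: (entourage_refl _ entC).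
pose S := [set p : prod_topology coset_space * prod_topology coset_space |
  p.1 l = p.2 l].
exists S; last by move=> [x y] /= xy; apply: lE.
have entS : @entourage (initial_topology (@proj _ coset_space l)) S.
  exists [set p | p.1 = p.2] => //.
  by rewrite (@uniform_discrete (discrete_topology _)) => _ [z _ <-].
exists S => //.
pose p0 : {p : {classic nat} * set _ |
    `[< @entourage (initial_topology (@proj _ coset_space p.1)) p.2 >]} :=
  exist _ (l, S) (asboolT entS).
by exists [fset p0]%fset => [p _|]; rewrite ?in_setT // set_fset1 bigcap_set1.
Qed.

Lemma nbhs_limitP (x : inverse_limit) (U : set inverse_limit) :
  nbhs x U <-> exists l, [set y | coord x l = coord y l] `<=` U.
Proof.
rewrite -nbhs_entourageE; split=> [[E /entourage_limitP[l lE] EU]|[l lU]].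
  by exists l => y xy; apply: EU; apply/xsectionP; exact: lE.
exists [set xy | coord xy.1 l = coord xy.2 l].
  by apply/entourage_limitP; exists l.
by move=> y /xsectionP /lU.
Qed.

Lemma coset_act1 l (C : coset_space l) : coset_act 1 C = C.
Proof. by have [h ->] := coset_surj C; rewrite coset_actE mul1g. Qed.

Lemma coset_actM l g h (C : coset_space l) :
  coset_act (g * h) C = coset_act g (coset_act h C).
Proof. by have [k ->] := coset_surj C; rewrite !coset_actE mulgA. Qed.

Lemma coset_act_quotient l g (C : coset_space l.+1) :
  coset_quotient (coset_act g C) = coset_act g (coset_quotient C).
Proof.
by have [k ->] := coset_surj C; rewrite coset_actE !coset_quotientE coset_actE.
Qed.

Lemma translation_subproof g (x : inverse_limit) l :
  coset_quotient (coset_act g (coord x l.+1)) = coset_act g (coord x l).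
Proof. by rewrite coset_act_quotient coordS. Qed.

Definition translation g (x : inverse_limit) : inverse_limit :=
  @mk_limit (fun l => coset_act g (coord x l)) (translation_subproof g x).

Lemma coord_translation g x l :
  coord (translation g x) l = coset_act g (coord x l).
Proof. by []. Qed.

Lemma translation1 : translation 1 =1 id.
Proof. by move=> x; apply: limit_eqP => l; exact: coset_act1. Qed.

Lemma translationM g h x :
  translation (g * h) x = translation g (translation h x).
Proof. by apply: limit_eqP => l; exact: coset_actM. Qed.

Lemma translationK g : cancel (translation g) (translation g^-1).
Proof. by move=> x; rewrite -translationM mulVg translation1. Qed.

Lemma translationKV g : cancel (translation g^-1) (translation g).
Proof. by move=> x; rewrite -translationM mulgV translation1. Qed.

Lemma translation_continuous g : continuous (translation g).
Proof.
move=> x U /nbhs_limitP[l lU]; apply/nbhs_limitP; exists l => y /= xy.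
by apply: lU; rewrite /= !coord_translation xy.
Qed.

Definition renormalization_action g : Homeo inverse_limit :=
  Homeomorphism (translationK g) (translationKV g)
    (@translation_continuous g) (@translation_continuous g^-1).

Fact renormalization_action_morphism :
  {morph renormalization_action : g h / g / h}.
Proof.
by move=> g h; apply: homeoP => x /=; rewrite translationM.
Qed.

HB.instance Definition _ := isGroupMorphism.Build G (Homeo inverse_limit)
  renormalization_action renormalization_action_morphism.

Definition profinite_closure : set (Homeo inverse_limit) :=
  closure (range renormalization_action).

Definition discriminant : set (Homeo inverse_limit) :=
  [set f | profinite_closure f /\ f basepoint = basepoint].

Lemma profinite_closureP (f : Homeo inverse_limit) :
  profinite_closure f <->
  forall l, exists g, forall x, coord (f x) l = coset_act g (coord x l).
Proof.
pose T := {uniform inverse_limit -> inverse_limit}.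
pose c (h : Homeo inverse_limit) : T := (h : inverse_limit -> inverse_limit).
split=> [fcl l|fl U].
  have /fcl[_ [[g _ <-] /= fg]] :
      nbhs f (c @^-1` [set k : T | forall x, coord (f x) l = coord (k x) l]).
    apply: (@initial_continuous _ _ c f); apply/uniform_nbhs.
    exists [set xy | coord xy.1 l = coord xy.2 l]; split.
      by apply/entourage_limitP; exists l.
    by move=> k /= fk x; exact: fk.
  by exists g => x; rewrite fg.
move=> [_ [[W oW <-] /= Wf WU]].
have /uniform_nbhs[E [/entourage_limitP[l lE] EW]] : nbhs (c f) W.
  exact: open_nbhs_nbhs.
have [g fg] := fl l; exists (renormalization_action g); split; first by exists g.
by apply: WU; apply: EW => x _; apply: lE; rewrite /= fg.
Qed.

Lemma discriminant_group_closed : group_closed (mem discriminant).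
Proof.
have clV f : profinite_closure f -> profinite_closure f^-1.
  move=> /profinite_closureP fP; apply/profinite_closureP => l.
  have [g fg] := fP l; exists g^-1 => x.
  by rewrite -{2}(homeo_invK f x) fg -coset_actM mulVg coset_act1.
have clM f h : profinite_closure f -> profinite_closure h ->
    profinite_closure (f * h).
  move=> /profinite_closureP fP /profinite_closureP hP.
  apply/profinite_closureP => l.
  have [a fa] := fP l; have [b hb] := hP l; exists (a * b) => x.
  by rewrite coset_actM -hb -fa.
split.
  apply: mem_set; split=> //; apply/profinite_closureP => l.
  by exists 1 => x; rewrite coset_act1.
move=> f h /set_mem[fcl fx] /set_mem[hcl hx]; apply: mem_set; split.
  by apply: clM => //; exact: clV.
by rewrite /= -{1}hx homeo_funK.
Qed.

Definition discriminant_group : Type := {f | f \in discriminant}.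

HB.instance Definition _ := [isSub for (@sval _ _ : discriminant_group -> _)].
HB.instance Definition _ := [Choice of discriminant_group by <:].
HB.instance Definition _ := SubChoice_isSubGroup.Build
  (Homeo inverse_limit) (mem discriminant) discriminant_group
  discriminant_group_closed.

End RenormalizationAction.

Definition orbit_relation (G : groupType) (X : topologicalType)
    (a : UMagmaMorphism.type G (Homeo X)) : set (X * X) :=
  [set p | exists g, p.2 = a g p.1].

(** [discrete_topology G] makes the acting groups discrete; [alpha] and [beta]
    are not required to be cocycles. *)
Definition continuous_orbit_equivalence (G G' : groupType)
    (X X' : topologicalType)
    (a : UMagmaMorphism.type G (Homeo X))
    (a' : UMagmaMorphism.type G' (Homeo X'))
    (h : homeomorphism X X')
    (alpha : discrete_topology G * X -> discrete_topology G')
    (beta : discrete_topology G' * X' -> discrete_topology G) : Prop :=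
  [/\ [set (h p.1, h p.2) | p in orbit_relation a] = orbit_relation a',
      [set (homeo_inv h p.1, homeo_inv h p.2) | p in orbit_relation a'] =
        orbit_relation a,
      continuous alpha /\ continuous beta,
      forall g x, exists U : set X,
        [/\ open U, U x &
          {in U, a' (alpha (g, x)) \o h =1 h \o a g}]
    & forall g' y, exists V : set X',
        [/\ open V, V y &
          {in V, a (beta (g', y)) \o homeo_inv h =1 homeo_inv h \o a' g'}]].

Definition continuously_orbit_equivalent (G G' : groupType)
    (X X' : topologicalType)
    (a : UMagmaMorphism.type G (Homeo X))
    (a' : UMagmaMorphism.type G' (Homeo X')) : Prop :=
  exists h alpha beta,
    @continuous_orbit_equivalence G G' X X' a a' h alpha beta.

Definition isomorphic (G H : groupType) : Prop :=
  exists2 f : G -> H, bijective f & {morph f : x y / x * y}.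

(* Main.v *)
Require Import Defs.
From HB Require Import structures.
From mathcomp Require Import all_boot fingroup perm.
From mathcomp Require Import all_classical topology.

Set Implicit Arguments.
Unset Strict Implicit.
Unset Printing Implicit Defensive.

Local Open Scope classical_set_scope.
Local Open Scope group_scope.

(** Write [A] for the closure of [G] in [Homeo X], [x0] for the base point, and
    call the set of points of [X] that agree with [y] at level [n] a cylinder
    around [y].  The discriminant group is the stabilizer of [x0] in [A].  The
    proof has two halves.

    Elements of [A] are determined by their germs ([closure_germ]).  Let [C_l]
    be the kernel of the action of [G] on level [l].  The cylinder of level [k]
    around [x0] is a copy of [X] on which [phi^k g] acts as [g] acts on [X], so
    an element that is trivial on this cylinder to depth [k + l] lies in
    [phi^k(C_l)].  The claim is thus that [phi] is continuous for the filtration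
    [C_l], that is, that each [C_m] contains [phi(C_l)] for some [l]
    ([core_continuous]).  As [G] is finitely generated, it has only finitely
    many morphisms to a given finite group, so [C_m] contains a subgroup [N] of
    finite index with [phi(N)] in [N]: the common kernel of these morphisms.
    The images [E_l] of [C_l] in [G/N] decrease, and injectivity of [phi] makes
    [C_(l+1)] a part of [phi(C_l)].  As soon as [E_l] and [E_(l+1)] have the same
    cardinality, [phi] therefore maps [E_l] onto [E_(l+1)], and then [phi(C_l)]
    lies in [C_(l+1) N], hence in [C_m].

    An orbit equivalence [h] conjugates germs of [A] to germs of [A'].  By
    compactness of [X], one level [n] works for all points and for a finite set
    of generators: on each cylinder of level [n], a generator is conjugated by
    [h] to a single element of [G'].  The elements with this property form a
    subgroup, which is all of [G] ([uniform_local_conjugacy]); the level does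
    not depend on the element, and a limit argument extends the property to [A]
    ([closure_conjugacy]).

    Finally, [A'] is transitive on [X'], so [h] can be corrected by an element
    of [A'] to send [x0] to [x0'].  Conjugation of germs at the base points is
    then an isomorphism of the two stabilizers ([germ_isomorphism]). *)

(** * Morphisms from a finitely generated group to a finite group *)

Section FinitelyManyMorphisms.
Context {G : groupType} {T : finGroupType}.

Lemma morph_eq_on_generators (rho rho' : UMagmaMorphism.type G T) (s : seq G) :
  (forall S : {pred G}, group_closed S -> {subset s <= S} -> S =i predT) ->
  map rho s = map rho' s -> rho =1 rho'.
Proof.
move=> sG /eq_in_map rr' g; apply/eqP.
have := sG [pred g | rho g == rho' g] _ _ g; rewrite !inE; apply.
  split=> [|x y]; rewrite ?inE ?gmulf1 // => /eqP xE /eqP yE.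
  by rewrite !gmulfF xE yE.
by move=> x xs; rewrite inE rr'.
Qed.

(** The fibres of [q] are the cosets of the common kernel of all morphisms from
    [G] to [T].  There are finitely many of these, as a morphism is determined by
    its values on generators; this kernel is [phi]-invariant because morphisms
    can be precomposed with [phi], whence the map [Phi] that [phi] induces. *)
Lemma finite_invariant_quotient (phi : UMagmaMorphism.type G G)
    (rho : UMagmaMorphism.type G T) : finitely_generated G ->
  exists (F : finType) (q : G -> F) (Phi : F -> F),
    (forall g, q (phi g) = Phi (q g)) /\
    (forall g h, q g = q h -> rho g = rho h).
Proof.
move=> [s sG].
pose values (r : G -> T) := map_tuple r (in_tuple s).
(* [hom t] is the morphism with values [t] on the generators, or [rho] if
   there is none. *)
have /choice[hom homP] (t : (size s).-tuple T) :
    exists r : UMagmaMorphism.type G T,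
      forall r' : UMagmaMorphism.type G T, values r' = t -> r =1 r'.
  have [[r rt]|no] := pselect (exists r : UMagmaMorphism.type G T, values r = t).
    exists r => r' r't; apply: morph_eq_on_generators sG _.
    by apply: (congr1 val (etrans rt (esym r't))).
  by exists rho => r r't; case: no; exists r.
exists {ffun (size s).-tuple T -> T}, (fun g => [ffun t => hom t g]).
exists (fun f : {ffun (size s).-tuple T -> T} =>
  [ffun t => f (values (hom t \o phi))]).
split=> [g|g h].
  apply/ffunP => t; rewrite !ffunE.
  exact/esym/(homP _ (hom t \o phi) erefl).
by move=> /ffunP/(_ (values rho)); rewrite !ffunE !(homP _ rho erefl).
Qed.

End FinitelyManyMorphisms.

(** * The action on a finite level *)

Section Levels.
Context {G : groupType} (phi : UMagmaMorphism.type G G).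
Implicit Types (g h : G) (l m k : nat).

Lemma iter_morphM l : {morph iter l phi : g h / g * h}.
Proof. by elim: l => [|l IH] g h //=; rewrite IH gmulfM. Qed.

Lemma iter_morph1 l : iter l phi 1 = 1.
Proof. by elim: l => //= l ->; rewrite gmulf1. Qed.

Lemma iter_morphV l : {morph iter l phi : g / g^-1}.
Proof. by elim: l => [|l IH] g //=; rewrite IH gmulfV. Qed.

Lemma iter_inj l : injective phi -> injective (iter l phi).
Proof. by move=> phiI; elim: l => [|l IH] g h //= /phiI/IH. Qed.

Lemma coset_eqP l g h :
  coset phi l g = coset phi l h <-> exists c, h = g * iter l phi c.
Proof.
split=> [/(congr1 set_val)|[c ->]].
  rewrite !set_valE /= => gh.
  have : translate h (subgroup_ phi l) h.
    by exists 1; [exact: subgroup_1 | rewrite mulg1].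
  by rewrite -gh => -[_ [c _ <-] <-]; exists c.
apply: eq_sig_hprop => [? ? ?|/=]; first exact: Prop_irrelevance.
apply/seteqP; split=> [_ [_ [k _ <-] <-]|_ [_ [k _ <-] <-]].
  exists (iter l phi (c^-1 * k)); first by exists (c^-1 * k).
  by rewrite iter_morphM iter_morphV !mulgA mulgK.
exists (iter l phi (c * k)); first by exists (c * k).
by rewrite iter_morphM mulgA.
Qed.

(** If [t] represents the cosets of [phi(G)] and [s] those of [phi^l(G)], then
    the elements [a * phi b] represent the cosets of [phi^(l+1)(G)]. *)
Lemma finite_coset_space l : finite_index (range phi) ->
  exists s : seq G, forall g, exists2 a, a \in s & coset phi l g = coset phi l a.
Proof.
move=> fin; elim: l => [|l [s sP]].
  exists [:: 1] => g; exists 1; first by rewrite inE.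
  by apply/coset_eqP; exists g^-1; rewrite /= mulgV.
have [t tP] : exists t : seq G, forall g, exists2 a, a \in t & exists c, g = a * phi c.
  move/finite_seqP: fin => [L LE].
  have /choice[r rP] (C : set G) : exists a, C \in L -> C a.
    have [CL|_] := boolP (C \in L); last by exists 1.
    have : [set` L] C by [].
    rewrite -LE => -[g _ <-]; exists g => _; exists 1; last by rewrite mulg1.
    by exists 1 => //; exact: gmulf1.
  exists (map r L) => g.
  have gL : translate g (range phi) \in L.
    by have : [set` L] (translate g (range phi)) by rewrite -LE; exists g.
  exists (r (translate g (range phi))); first by rewrite map_f.
  have [_ [c _ <-] <-] := rP _ gL.
  by exists c^-1; rewrite gmulfV mulgK.
exists [seq a * phi b | a <- t, b <- s] => g.
have [a at_ [c ->]] := tP g; have [b bs /coset_eqP[d bE]] := sP c.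
exists (a * phi b); first by apply/allpairsP; exists (a, b).
by apply/coset_eqP; exists d; rewrite bE gmulfM mulgA.
Qed.

(** The kernel of the action on level [l] is the normal core of [phi^l(G)]
    (see [coreP]). *)
Definition core l : set G :=
  [set g | forall C : coset_space phi l, coset_act g C = C].

Lemma core_eqP l g h :
  core l (h^-1 * g) <->
  forall C : coset_space phi l, coset_act g C = coset_act h C.
Proof.
split=> gh C; last by rewrite coset_actM gh -coset_actM mulVg coset_act1.
by rewrite -{2}(gh C) -coset_actM mulgA mulgV mul1g.
Qed.

Lemma finite_level l : finite_index (range phi) ->
  exists (T : finGroupType) (rho : UMagmaMorphism.type G T),
    forall g, rho g = 1 <-> core l g.
Proof.
move=> /(finite_coset_space l)[s sP].
pose L : seq (coset_space phi l) := map (coset phi l) s.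
have LC C : C \in L.
  have [g ->] := coset_surj C; have [a as_ ->] := sP g.
  exact: map_f.
(* Products of permutations compose from left to right: the inverse turns the
   left action into a morphism. *)
pose act g (C : seq_sub L) := SeqSub (LC (coset_act g^-1 (val C))).
have actI g : injective (act g).
  move=> C D /(congr1 val) /= /(congr1 (coset_act g)).
  by rewrite -!coset_actM mulgV !coset_act1 => /val_inj.
pose rho g : {perm seq_sub L} := perm (@actI g).
have rhoM : {morph rho : g h / g * h}.
  move=> g h; apply/permP => C; rewrite permM !permE; apply: val_inj => /=.
  by rewrite invMg coset_actM.
have rhoF : {morph rho : g h / g / h}.
  by move=> g h; rewrite -{2}[g](mulgKV h) (rhoM (g / h)) mulgK.
pose rhom : UMagmaMorphism.type G {perm seq_sub L} :=
  HB.pack rho (isGroupMorphism.Build G {perm seq_sub L} rho rhoF).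
exists {perm seq_sub L}, rhom => g; split=> [/permP gE C|gC]; last first.
  apply/permP => C; rewrite !permE; apply: val_inj => /=.
  by rewrite -{1}(gC (val C)) -coset_actM mulVg coset_act1.
have /(congr1 val) := gE (SeqSub (LC C)); rewrite !permE /= => {1}<-.
by rewrite -coset_actM mulgV coset_act1.
Qed.

Lemma coreJ l g u : core l g -> core l (u * g * u^-1).
Proof.
by move=> gC C; rewrite !coset_actM gC -coset_actM mulgV coset_act1.
Qed.

Lemma coreP l g : core l g <-> forall u, exists c, u^-1 * g * u = iter l phi c.
Proof.
split=> [gC u|gu C].
  have := gC (coset phi l u); rewrite coset_actE => /esym/coset_eqP[c cE].
  by exists c; rewrite -mulgA cE mulKg.
have [u ->] := coset_surj C; have [c cE] := gu u.
by rewrite coset_actE; apply/esym/coset_eqP; exists c; rewrite -cE !mulgA mulgV mul1g.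
Qed.

Lemma core_le l m g : (l <= m)%N -> core m g -> core l g.
Proof.
move=> /subnKC <- /coreP gm; apply/coreP => u; have [c ->] := gm u.
by exists (iter (m - l) phi c); rewrite iterD.
Qed.

(** * Continuity of the renormalization for the filtration by cores *)

(** Being in the core of [phi^l(G)] can be tested after applying [phi^k], even
    if the conjugating elements are restricted to [phi^k(G)]. *)
Lemma core_image k l g : injective phi ->
  (forall c, exists d, iter k phi (c^-1 * g * c) = iter (k + l) phi d) ->
  core l g.
Proof.
move=> phiI gk; apply/coreP => u; have [d dE] := gk u.
by exists d; apply: (iter_inj phiI (l := k)); rewrite dE iterD.
Qed.

Lemma core_descent l g : injective phi -> core l.+1 g ->
  exists2 h, core l h & g = phi h.
Proof.
move=> phiI /coreP gC; have [c] := gC 1; rewrite invg1 mul1g mulg1 => gE.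
exists (iter l phi c) => //; apply: (@core_image 1) => // u.
have [d dE] := gC (phi u); exists d.
by rewrite [RHS](esym dE) gE /= !gmulfM gmulfV.
Qed.

(** The counting argument that carries the proof.  The sets [E l] decrease in a
    finite set and [Phi] maps [E l] onto a set that contains [E l.+1]; when two
    consecutive cardinalities agree, [Phi (E l) = E l.+1], so [phi g] has the
    same image under [q], hence under [rho], as an element of [core l.+1]. *)
Lemma core_continuous m :
  finitely_generated G -> injective phi -> finite_index (range phi) ->
  exists l, forall g, core l g -> core m (phi g).
Proof.
move=> fgG phiI fin.
have [T [rho rhoP]] := finite_level m fin.
have [F [q [Phi [qphi qrho]]]] := finite_invariant_quotient phi rho fgG.
pose E l : {set F} := [set x | `[< exists2 g, core l g & q g = x >]]%SET.
have inE l x : x \in E l <-> exists2 g, core l g & q g = x.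
  by rewrite inE; split=> /asboolP.
have Esub l : E l.+1 \subset E l.
  apply/fintype.subsetP => x /inE[g gC <-]; apply/inE; exists g => //.
  exact: core_le gC.
have Ephi l : E l.+1 \subset [set Phi x | x in E l]%SET.
  apply/fintype.subsetP => _ /inE[g /(core_descent phiI)[h hC ->] <-].
  by rewrite qphi; apply/imsetP; exists (q h) => //; apply/inE; exists h.
have [l lm cardE] : exists2 l, (m <= l)%N & #|E l| = #|E l.+1|.
  apply: contrapT => noE.
  have cE l : (m <= l)%N -> (#|E l.+1| < #|E l|)%N.
    move=> ml; rewrite ltn_neqAle subset_leq_card // andbT; apply/eqP => lE.
    by apply: noE; exists l.
  have dec n : (#|E (m + n)%N| + n <= #|E m|)%N.
    elim: n => [|n IH]; first by rewrite !addn0.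
    apply: leq_trans IH; rewrite !addnS -addSn leq_add2r.
    by apply: cE; exact: leq_addr.
  have := leq_trans (leq_addl _ _) (dec #|E m|.+1); by rewrite ltnn.
exists l => g gC.
have : Phi (q g) \in [set Phi x | x in E l]%SET.
  by apply: imset_f; apply/inE; exists g.
have <- : E l.+1 = [set Phi x | x in E l]%SET.
  by apply/eqP; rewrite eqEcard Ephi -cardE leq_imset_card.
rewrite -qphi => /inE[h hC /qrho hE].
by apply/rhoP; rewrite -hE; apply/rhoP; apply: core_le hC; exact: leqW.
Qed.

Lemma core_iter_continuous k m :
  finitely_generated G -> injective phi -> finite_index (range phi) ->
  exists l, forall g, core l g -> core m (iter k phi g).
Proof.
move=> fgG phiI fin; elim: k => [|k [l lm]]; first by exists m.
have [l' l'l] := core_continuous l fgG phiI fin.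
by exists l' => g /l'l/lm; rewrite -iterSr.
Qed.

(** * Elements of the closure are determined by their germs *)

(** With [coord y k = u phi^k(G)], the cylinder is the translate by [u] of the
    cylinder of [x0], which is a copy of [X].  Triviality on it at level [k + l]
    means that [u^-1 * g * u] is [phi^k b] with [b] in [core l]; continuity of
    [phi^k] for the cores then puts [g] in [core m]. *)
Lemma level_rigidity (y : inverse_limit phi) k m :
  finitely_generated G -> injective phi -> finite_index (range phi) ->
  exists l, forall g,
    (forall z, coord z k = coord y k -> coord (translation g z) l = coord z l) ->
    core m g.
Proof.
move=> fgG phiI fin.
have [l lm] := core_iter_continuous k m fgG phiI fin.
exists (k + l)%N => g gfix; have [u uE] := coset_surj (coord y k).
have gu c : exists d, (u * iter k phi c)^-1 * g * (u * iter k phi c) =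
    iter (k + l) phi d.
  have := gfix (translation (u * iter k phi c) (basepoint phi)).
  rewrite !coord_translation !coset_actE mulg1 uE => /(_ _)/esym/coset_eqP[].
    by apply/esym/coset_eqP; exists c.
  by move=> d dE; exists d; rewrite -mulgA dE mulKg.
have [d0 d0E] := gu 1; rewrite iter_morph1 mulg1 in d0E.
have -> : g = u * iter k phi (iter l phi d0) * u^-1.
  by rewrite -iterD -d0E !mulgA mulgV mul1g mulgK.
apply/coreJ/lm/(core_image (k := k)) => // c; have [d dE] := gu c; exists d.
by rewrite -dE !iter_morphM iter_morphV -iterD -d0E invMg !mulgA.
Qed.

(** The closure acts quasi-analytically: at each level both maps are translations
    by elements of [G], to whose quotient [level_rigidity] applies. *)
Lemma closure_germ (y : inverse_limit phi)
    (f1 f2 : Homeo (inverse_limit phi)) :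
  finitely_generated G -> injective phi -> finite_index (range phi) ->
  profinite_closure f1 -> profinite_closure f2 ->
  (\forall z \near y, f1 z = f2 z) -> f1 = f2.
Proof.
move=> fgG phiI fin /profinite_closureP f1A /profinite_closureP f2A.
move=> /nbhs_limitP[k f12].
apply: homeoP => x; apply: limit_eqP => m.
have [l lm] := level_rigidity y k m fgG phiI fin.
have [g1 g1P] := f1A (maxn l m); have [g2 g2P] := f2A (maxn l m).
have g1E n z : (n <= maxn l m)%N -> coord (f1 z) n = coset_act g1 (coord z n).
  by move=> nlm; have := g1P z; rewrite -coord_translation; exact: coord_le.
have g2E n z : (n <= maxn l m)%N -> coord (f2 z) n = coset_act g2 (coord z n).
  by move=> nlm; have := g2P z; rewrite -coord_translation; exact: coord_le.
rewrite g1E ?leq_maxr // g2E ?leq_maxr //; move: (coord x m).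
apply/core_eqP/lm => z zy.
rewrite coord_translation coset_actM -g1E ?leq_maxl // f12; last exact/esym.
by rewrite g2E ?leq_maxl // -coset_actM mulVg coset_act1.
Qed.

(** * Compactness of the closure and of the space *)

Lemma compatible_limit (a : nat -> G) :
  (forall m (C : coset_space phi m), coset_act (a m.+1) C = coset_act (a m) C) ->
  exists2 f : Homeo (inverse_limit phi), profinite_closure f &
    forall m x, coord (f x) m = coset_act (a m) (coord x m).
Proof.
move=> aS.
have aK m (C : coset_space phi m) : coset_act (a m)^-1 (coset_act (a m) C) = C.
  by rewrite -coset_actM mulVg coset_act1.
have aVK m (C : coset_space phi m) : coset_act (a m) (coset_act (a m)^-1 C) = C.
  by rewrite -coset_actM mulgV coset_act1.
have aVS m (C : coset_space phi m) :
    coset_act (a m.+1)^-1 C = coset_act (a m)^-1 C.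
  by rewrite -{1}(aVK m C) -aS -coset_actM mulVg coset_act1.
have compat (b : nat -> G) :
    (forall m (C : coset_space phi m), coset_act (b m.+1) C = coset_act (b m) C) ->
    forall (x : inverse_limit phi) m,
    coset_quotient (coset_act (b m.+1) (coord x m.+1)) = coset_act (b m) (coord x m).
  by move=> bS x m; rewrite coset_act_quotient coordS bS.
have cont (b : nat -> G) bS :
    continuous (fun x => mk_limit (compat b bS x)).
  move=> x V /nbhs_limitP[l lV]; apply/nbhs_limitP; exists l => y /= xy.
  by apply: lV; exact: (congr1 (coset_act (b l)) xy).
have fK : cancel (fun x => mk_limit (compat a aS x))
    (fun x => mk_limit (compat (fun m => (a m)^-1) aVS x)).
  by move=> x; apply: limit_eqP => m; exact: aK.
have fVK : cancel (fun x => mk_limit (compat (fun m => (a m)^-1) aVS x))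
    (fun x => mk_limit (compat a aS x)).
  by move=> x; apply: limit_eqP => m; exact: aVK.
exists (Homeomorphism fK fVK (cont a aS) (cont _ aVS)) => //.
by apply/profinite_closureP => m; exists (a m).
Qed.

(** Sequential compactness of the closure.  Each level sees finitely many
    permutations, so a nonprincipal ultrafilter on the indices selects, at every
    level [m], the action of one element [a m] by which almost all [g l] act;
    these choices are compatible because two large sets of indices meet. *)
Lemma limit_point (g : nat -> G) : finite_index (range phi) ->
  exists f : Homeo (inverse_limit phi), profinite_closure f /\
    forall m, exists2 l, (m <= l)%N &
      forall x, coord (f x) m = coset_act (g l) (coord x m).
Proof.
move=> fin.
have [U [UU Uoo]] := ultraFilterLemma eventually_filter.
have /choice[a aU] m : exists a, U [set l | core m (a^-1 * g l)].
  have [T [rho rhoP]] := finite_level m fin.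
  apply: contrapT => noa.
  have UC t : U [set l | rho (g l) <> t].
    have [|//] := in_ultra_setVsetC [set l | rho (g l) = t] UU.
    move=> Ut; case: noa; have [l0 l0t] := filter_ex Ut.
    exists (g l0); apply: filterS Ut => l lt.
    by apply/rhoP; rewrite gmulfM gmulfV lt l0t mulVg.
  by have [l /(_ (rho (g l)))] := filter_ex (filter_forall _ UC).
have aP m n : exists2 l, (m <= l)%N &
    core m ((a m)^-1 * g l) /\ core n ((a n)^-1 * g l).
  have Um : U [set l | (m <= l)%N] by apply: Uoo; exists m.
  by have [l [[? ?] ?]] := filter_ex (filterI (filterI (aU m) (aU n)) Um);
    exists l.
have aS m (C : coset_space phi m) : coset_act (a m.+1) C = coset_act (a m) C.
  have [l _ [/core_eqP h1 /(core_le (leqnSn m))/core_eqP h2]] := aP m m.+1.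
  by rewrite -h1 -h2.
have [f fA fE] := compatible_limit aS; exists f; split=> // m.
have [l ml [/core_eqP gl _]] := aP m m.
by exists l => // x; rewrite fE gl.
Qed.

Lemma closureM (f1 f2 : Homeo (inverse_limit phi)) :
  profinite_closure f1 -> profinite_closure f2 -> profinite_closure (f1 * f2).
Proof.
move=> /profinite_closureP f1A /profinite_closureP f2A.
apply/profinite_closureP => l; have [g1 g1P] := f1A l; have [g2 g2P] := f2A l.
by exists (g1 * g2) => x; rewrite coset_actM -g2P -g1P.
Qed.

Lemma closureV (f : Homeo (inverse_limit phi)) :
  profinite_closure f -> profinite_closure f^-1.
Proof.
move=> /profinite_closureP fA; apply/profinite_closureP => l.
have [g gP] := fA l; exists g^-1 => x.
by rewrite -{2}(homeo_invK f x) gP -coset_actM mulVg coset_act1.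
Qed.

(** Some subsequence of [x] converges to a point of the orbit of the base point
    under the closure.  For constant sequences this gives transitivity of the
    closure, and in general it gives compactness of [X]. *)
Lemma sequentially_compact (x : nat -> inverse_limit phi) :
  finite_index (range phi) ->
  exists f : Homeo (inverse_limit phi), profinite_closure f /\
    forall m, exists2 l, (m <= l)%N & coord (f (basepoint phi)) m = coord (x l) m.
Proof.
move=> fin; have /choice[u uE] l := coset_surj (coord (x l) l).
have [f [fA fP]] := limit_point u fin; exists f; split=> // m.
have [l ml fE] := fP m; exists l => //; rewrite fE -coord_translation.
by apply: coord_le ml _; rewrite coord_translation coset_actE mulg1 uE.
Qed.

Lemma closure_transitive (x : inverse_limit phi) : finite_index (range phi) ->
  exists2 f : Homeo (inverse_limit phi), profinite_closure f & f (basepoint phi) = x.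
Proof.
move=> fin; have [f [fA fP]] := sequentially_compact (fun=> x) fin.
by exists f => //; apply: limit_eqP => m; have [] := fP m.
Qed.

End Levels.

(** * Conjugating germs by an orbit equivalence *)

Lemma near_continuous (X Y : topologicalType) (f : X -> Y) (x : X) (P : set Y) :
  continuous f -> (\forall y \near f x, P y) -> \forall z \near x, P (f z).
Proof. by move=> fcont fxP; exact: (fcont x). Qed.

Section LocalConjugacy.
Context {G G' : groupType}.
Variables (phi : UMagmaMorphism.type G G) (phi' : UMagmaMorphism.type G' G').
Variable h : inverse_limit phi -> inverse_limit phi'.

(** Compactness gives the level [n] for finitely many generators.  The elements
    that satisfy the conclusion for this [n] form a subgroup since every
    element of [G] permutes the cylinders of level [n]. *)
Lemma uniform_local_conjugacy :
  finitely_generated G -> finite_index (range phi) ->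
  (forall g (x : inverse_limit phi), exists g',
    \forall z \near x, h (translation g z) = translation g' (h z)) ->
  exists n, forall g x, exists g',
    forall z, coord z n = coord x n -> h (translation g z) = translation g' (h z).
Proof.
move=> [s sG] fin hloc.
(* If no level works for [g], there are points [x n] with a bad cylinder of
   level [n]; a limit point of these contradicts the hypothesis. *)
have /choice[N NP] g : exists n, forall x, exists g',
    forall z, coord z n = coord x n -> h (translation g z) = translation g' (h z).
  apply: contrapT => /forallNP noN.
  have /choice[x xP] n : exists x, forall g', ~ forall z, coord z n = coord x n ->
      h (translation g z) = translation g' (h z).
    by have /existsNP[x /forallNP xP] := noN n; exists x.
  have [f [_ fP]] := sequentially_compact x fin.
  have [g' /nbhs_limitP[m mP]] := hloc g (f (basepoint phi)).
  have [l ml fE] := fP m; apply: (xP l g') => z zx; apply: mP.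
  by rewrite /= fE; exact/esym/(coord_le ml).
pose n := (\max_(g <- s) N g)%N; exists n => g.
pose S : set G := [set g | forall x, exists g',
  forall z, coord z n = coord x n -> h (translation g z) = translation g' (h z)].
suff /(_ g) gS : mem S =i predT by apply: (@set_mem _ S); rewrite gS.
apply: sG => [|{}g gs]; last first.
  apply: (@mem_set _ S) => x; have [g' g'P] := NP g x; exists g' => z zx.
  by apply: g'P; apply: coord_le zx; exact: (@leq_bigmax_seq _ s xpredT N).
split=> [|g1 g2].
  by apply: (@mem_set _ S) => x; exists 1 => z _; rewrite !translation1.
move=> /(@set_mem _ S) g1P /(@set_mem _ S) g2P; apply: (@mem_set _ S) => x.
have [g2' g2'P] := g2P (translation g2^-1 x).
have [g1' g1'P] := g1P (translation g2^-1 x).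
exists (g1' * g2'^-1) => z zx; rewrite !translationM.
have zx2 : coord (translation g2^-1 z) n = coord (translation g2^-1 x) n.
  by rewrite !coord_translation zx.
by rewrite g1'P // -{2}(translationKV g2 z) g2'P // translationK.
Qed.

(** If [g l] agrees with [f] at level [l] and [h] conjugates [g l] to [g' l] on
    the cylinder around [x], then [h] conjugates [f] on this cylinder to any
    limit point of the sequence [g'].  This needs the cylinder not to
    shrink with [l]. *)
Lemma closure_conjugacy n : continuous h -> finite_index (range phi') ->
  (forall g x, exists g',
    forall z, coord z n = coord x n -> h (translation g z) = translation g' (h z)) ->
  forall (f : Homeo (inverse_limit phi)) (x : inverse_limit phi),
  profinite_closure f ->
  exists2 f' : Homeo (inverse_limit phi'), profinite_closure f' &
    \forall z \near x, h (f z) = f' (h z).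
Proof.
move=> hcont fin' hn f x /profinite_closureP/choice[g gP].
have /choice[g' g'P] l := hn (g l) x.
have [f' [f'A f'P]] := limit_point g' fin'; exists f' => //.
apply/nbhs_limitP; exists n => z zx; apply: limit_eqP => m.
have /nbhs_limitP[k kP] : nbhs (f z) [set y | coord (h (f z)) m = coord (h y) m].
  apply: (hcont (f z) [set w | coord (h (f z)) m = coord w m]).
  by apply/nbhs_limitP; exists m.
have [l kml f'E] := f'P (maxn k m); move: kml; rewrite geq_max => /andP[kl ml].
have -> : coord (f' (h z)) m = coord (translation (g' l) (h z)) m.
  by apply: coord_le (leq_maxr k m) _; rewrite f'E.
rewrite -g'P //; apply: kP => /=.
by apply: coord_le kl _; rewrite gP.
Qed.

End LocalConjugacy.

(** * Germs at the base points *)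

Lemma isomorphic_of_relation (G H : groupType) (R : G -> H -> Prop) :
  (forall x, exists y, R x y) -> (forall y, exists x, R x y) ->
  (forall x y y', R x y -> R x y' -> y = y') ->
  (forall x x' y, R x y -> R x' y -> x = x') ->
  (forall x y x' y', R x y -> R x' y' -> R (x * x') (y * y')) ->
  isomorphic G H.
Proof.
move=> /choice[f fP] /choice[g gP] Rfun Rinj RM; exists f.
  exists g => [x|y]; [exact: Rinj (gP _) (fP x) | exact: Rfun (fP _) (gP y)].
by move=> x y; apply: Rfun (fP _) (RM _ _ _ _ (fP x) (fP y)).
Qed.

(** The isomorphism relates [d] to the [d'] whose germ at the base point is the
    conjugate of the germ of [d] by [k].  The hypotheses make this relation
    total on both sides, and [closure_germ] makes it one-to-one. *)
Lemma germ_isomorphism (G G' : groupType)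
    (phi : UMagmaMorphism.type G G) (phi' : UMagmaMorphism.type G' G')
    (k : homeomorphism (inverse_limit phi) (inverse_limit phi')) :
  finitely_generated G -> finitely_generated G' ->
  injective phi -> injective phi' ->
  finite_index (range phi) -> finite_index (range phi') ->
  k (basepoint phi) = basepoint phi' ->
  (forall f : Homeo (inverse_limit phi), profinite_closure f ->
    exists2 f' : Homeo (inverse_limit phi'), profinite_closure f' &
      \forall x \near basepoint phi, k (f x) = f' (k x)) ->
  (forall f' : Homeo (inverse_limit phi'), profinite_closure f' ->
    exists2 f : Homeo (inverse_limit phi), profinite_closure f &
      \forall x \near basepoint phi', homeo_inv k (f' x) = f (homeo_inv k x)) ->
  isomorphic (discriminant_group phi) (discriminant_group phi').
Proof.
move=> fgG fgG' phiI phiI' fin fin' k0 push pull.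
have kV0 : homeo_inv k (basepoint phi') = basepoint phi by rewrite -k0 homeo_funK.
have dA (d : discriminant_group phi) : discriminant (val d) := set_mem (valP d).
have dA' (d : discriminant_group phi') : discriminant (val d) := set_mem (valP d).
apply: (@isomorphic_of_relation (discriminant_group phi)
  (discriminant_group phi') (fun d d' =>
    \forall x \near basepoint phi, k (val d x) = val d' (k x))).
- move=> d; have [dcl d0] := dA d; have [f' f'A df'] := push _ dcl.
  have f'0 : discriminant f'.
    by split=> //; have := nbhs_singleton df'; rewrite /= d0 k0.
  by exists (Sub f' (mem_set f'0)).
- move=> d'; have [dcl d0] := dA' d'; have [f fA df] := pull _ dcl.
  have f0 : discriminant f.
    by split=> //; have := nbhs_singleton df; rewrite /= d0 kV0.
  exists (Sub f (mem_set f0)).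
  rewrite -k0 in df.
  apply: filterS (near_continuous (@homeo_continuous _ _ k) df) => x /=.
  by rewrite homeo_funK => <-; rewrite homeo_invK.
- move=> d d1 d2 dd1 dd2; apply/val_inj.
  have [[d1A _] [d2A _]] := (dA' d1, dA' d2).
  apply: (closure_germ (y := basepoint phi')) => //.
  have dd : \forall x \near basepoint phi, val d1 (k x) = val d2 (k x).
    by apply: filterS2 dd1 dd2 => x <-.
  rewrite -kV0 in dd.
  apply: filterS (near_continuous (@homeo_inv_continuous _ _ k) dd) => x /=.
  by rewrite homeo_invK.
- move=> d1 d2 d' dd1 dd2; apply/val_inj.
  have [[d1A _] [d2A _]] := (dA d1, dA d2).
  apply: (closure_germ (y := basepoint phi)) => //.
  by apply: filterS2 dd1 dd2 => x <- /(can_inj (@homeo_funK _ _ k)).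
- move=> d1 d1' d2 d2' dd1 dd2.
  have [_ d20] := dA d2; rewrite -d20 in dd1.
  have dd := near_continuous (@homeo_continuous _ _ (val d2)) dd1.
  by apply: filterS2 dd dd2 => x /= -> ->.
Qed.

Theorem theorem1p8 (G G' : groupType)
    (phi : UMagmaMorphism.type G G) (phi' : UMagmaMorphism.type G' G') :
  finitely_generated G -> finitely_generated G' ->
  renormalization phi -> renormalization phi' ->
  continuously_orbit_equivalent
    (renormalization_action phi) (renormalization_action phi') ->
  isomorphic (discriminant_group phi) (discriminant_group phi').
Proof.
move=> fgG fgG' ren ren' [h [alpha [beta [_ _ _ coe coe']]]].
have [[_ phiI _ fin] [_ phiI' _ fin']] := (ren, ren').
have [n hn] : exists n, forall g x, exists g',
    forall z, coord z n = coord x n -> h (translation g z) = translation g' (h z).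
  apply: uniform_local_conjugacy => // g x; exists (alpha (g, x)).
  have [U [Uo Ux UP]] := coe g x; apply: filterS (open_nbhs_nbhs (conj Uo Ux)).
  by move=> z Uz; have /= -> := UP z (mem_set Uz).
have [n' hn'] : exists n', forall g' x', exists g, forall z, coord z n' = coord x' n' ->
    homeo_inv h (translation g' z) = translation g (homeo_inv h z).
  apply: uniform_local_conjugacy => // g x; exists (beta (g, x)).
  have [U [Uo Ux UP]] := coe' g x; apply: filterS (open_nbhs_nbhs (conj Uo Ux)).
  by move=> z Uz; have /= -> := UP z (mem_set Uz).
(* Replacing [h] by [k] moves the image of the base point to the base point
   without leaving the closure. *)
have [t tA t0] := closure_transitive (h (basepoint phi)) fin'.
pose k := Homeomorphism (can_comp (@homeo_invK _ _ t) (@homeo_funK _ _ h))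
  (can_comp (@homeo_invK _ _ h) (@homeo_funK _ _ t))
  (fun x => continuous_comp (@homeo_continuous _ _ h x)
    (@homeo_inv_continuous _ _ t (h x)))
  (fun x => continuous_comp (@homeo_continuous _ _ t x)
    (@homeo_inv_continuous _ _ h (t x))).
apply: (@germ_isomorphism _ _ _ _ k) => //.
- by rewrite /= -t0 homeo_funK.
- move=> f fA.
  have [f' f'A ff'] :=
    closure_conjugacy (@homeo_continuous _ _ h) fin' hn (basepoint phi) fA.
  exists (t^-1 * f' * t); first exact/closureM/tA/closureM/f'A/closureV.
  by apply: filterS ff' => x /= ->; rewrite homeo_invK.
- move=> f' f'A.
  have [f fA ff'] := closure_conjugacy (@homeo_inv_continuous _ _ h) fin hn'
    (t (basepoint phi')) (closureM (closureM tA f'A) (closureV tA)).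
  exists f => //; apply: filterS (near_continuous (@homeo_continuous _ _ t) ff') => x /=.
  by rewrite homeo_funK.
Qed.
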